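(* Let $p$ be a prime, let $G$ be a finite group and let $N \trianglelefteq G$ be a normal subgroup such that $G/N$ is $p$-nilpotent. Suppose that every subgroup of $N$ of order $p$ is contained in the center $Z(G)$ and, if $p=2$, that every cyclic subgroup of $N$ of order $4$ is weakly $S\Phi$-supplemented in $G$. Then $G$ is $p$-nilpotent.
   Context: All groups are finite. A subgroup $A$ of $G$ is $S$-permutable in $G$ if $AQ=QA$ for all Sylow subgroups $Q$ of $G$ (for all primes). For a subgroup $H\le G$, $H_{sG}$ denotes the subgroup of $H$ generated by all subgroups of $H$ which are $S$-permutable in $G$. $\Phi(H)$ denotes the Frattini subgroup of $H$. A subgroup $H$ of $G$ is weakly $S\Phi$-supplemented in $G$ if there exists a subgroup $T$ of $G$ such that $G=HT$ and $H\cap T\le \Phi(H)H_{sG}$. A finite group is $p$-nilpotent if it has a normal $p$-complement. *)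

(* Defs.v *)
From mathcomp Require Import all_boot all_fingroup all_solvable.
Set Implicit Arguments.
Unset Strict Implicit.
Unset Printing Implicit Defensive.

Local Open Scope group_scope.

Section Definitions.

Variable gT : finGroupType.
Implicit Types G H A : {set gT}.

Definition s_permutable G A : bool :=
  (A \subset G) && [forall Q : {group gT}, Sylow G Q ==> (A * Q == Q * A)].

(* The subgroup written H_{sG} in the literature. *)
Definition s_core G H : {set gT} :=
  << \bigcup_(A : {group gT} | (A \subset H) && s_permutable G A) A >>.

(* 'Phi(H) * s_core G H is the pointwise product of two subgroups. *)
Definition weakly_sPhi_supplemented G H : Prop :=
  exists T : {group gT},
    [/\ T \subset G, G = H * T & H :&: T \subset 'Phi(H) * s_core G H].

(* A normal p-complement of G is a normal Hall p'-subgroup of G. *)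
Definition p_nilpotent (p : nat) G : Prop :=
  exists2 K : {group gT}, K <| G & p^'.-Hall(G) K.

End Definitions.

(* Main.v *)
Require Import Defs.
From mathcomp Require Import all_boot ssralg all_fingroup all_solvable.

(** Frobenius' criterion reduces the theorem to a local statement: it suffices
    that, for every prime [q] other than [p], every [q]-subgroup [Q] of [G]
    normalising a [p]-subgroup [D] of [G] centralises it
    ([Frobenius_p_nilpotent]).

    The criterion itself holds because the local condition makes any two Sylow
    [p]-subgroups [P] and [S] conjugate under the centraliser of [P :&: S]
    ([Sylow_conj_cent]), so that elements of [P] conjugate in [G] are already
    conjugate in [P].  The transfer into [P / P^`(1)] then gives
    [P :&: G^`(1) \subset P^`(1)] ([focal_subgroup_controlled]); hence, unless
    [P] is trivial, [G] has a proper normal subgroup of [p]-power index, and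
    one concludes by induction.

    To verify the local condition, let [E := [~: D, Q]].  As [G / N] is
    [p]-nilpotent, [E] lies in [N] ([commg_sub_p_nilpotent_quotient]), and as
    the action is coprime it is enough that [Q] centralises [E]
    ([coprime_comm_cent]).  This is [cent_of_weak_supplements]: in a minimal
    counterexample [E = [~: E, Q]] is a non-abelian special [p]-group with
    centre ['C_E(Q)].  If [p] is odd, the commutators generating [E] have order
    dividing [p], hence are centralised by [Q].  If [p = 2], some [x] of order
    [4] in [E] is not centralised by [Q].  When [<[x]>] is S-permutable in
    [E <*> Q], [Q] normalises it, and so centralises it by minimality; otherwise
    [<[x]>] has a supplement [T] not containing it, minimality forces
    [T :&: E] into ['Z(E)], and [E / 'Z(E)] is cyclic, making [E] abelian. *)

Import FiniteModule.
Set Implicit Arguments.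
Unset Strict Implicit.
Unset Printing Implicit Defensive.
Local Open Scope group_scope.

(** * Frobenius' criterion for p-nilpotency *)

Section Frobenius.
Variables (gT : finGroupType) (p : nat).
Implicit Types G P Q S T D M : {group gT}.

(** If [P] controls its own fusion, the transfer [V] from [G] to [P / P^`(1)]
    maps [g] in [P] to [g ^+ #|G : P|] modulo [P^`(1)], since each factor
    [(g ^+ n) ^ x^-1] of its cycle expansion is conjugate in [P] to [g ^+ n].
    As [V] kills [G^`(1)] and [#|G : P|] is prime to [p], the conclusion
    follows. *)
Lemma focal_subgroup_controlled G P :
    p.-Sylow(G) P ->
    (forall x g, x \in P -> g \in G -> x ^ g \in P ->
      exists2 h, h \in P & x ^ g = x ^ h) ->
  P :&: G^`(1) \subset P^`(1).
Proof.
move=> sylP fusP; have [sPG pP p'GP] := and3P sylP.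
pose alpha := restrm_morphism (der_norm 1 P) (coset P^`(1)).
have abP : abelian (alpha @* P).
  by rewrite morphim_restrm setIid; apply: der_abelian 0 P.
have G'ker : G^`(1) \subset 'ker (transfer_morphism G abP).
  rewrite gen_subG; apply/subsetP=> _ /imset2P[h1 h2 Gh1 Gh2 ->].
  by rewrite !inE groupR // morphR //; apply/commgP; apply: GRing.addrC.
apply/subsetP=> g /setIP[Pg G'g]; have Gg := subsetP sPG g Pg.
have Vg0 : (transfer G abP g = 0)%R by apply/(kerP _ Gg)/(subsetP G'ker).
have partX := rcosets_cycle_partition sPG Gg.
have trX := transversalP partX; set X := transversal _ _ in trX.
have /subsetP sXG := transversal_sub trX.
have : (fmod abP (alpha g) *+ #|G : P| = 0)%R.
  rewrite -Vg0 (transfer_cycle_expansion sPG abP Gg trX).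
  rewrite -(sum_index_rcosets_cycle sPG Gg trX) -GRing.sumrMnr.
  apply: eq_bigr => x Xx /=; rewrite -fmodX ?mem_morphim // -morphX //.
  set n := indexg _ _.
  have Pgnx : (g ^+ n) ^ x^-1 \in P.
    by rewrite conjgE invgK mulgA -mem_rcoset mulg_exp_card_rcosets.
  have [||h Ph ->] := fusP _ _ _ _ Pgnx; rewrite ?groupX ?groupV ?sXG //.
  congr fmod; rewrite morphJ ?groupX //.
  rewrite conjgE (centsP abP _ _ _ (mem_morphim alpha _ _)) ?mulKg //.
  by rewrite mem_morphim ?groupX.
move=> Vg; have aPg : alpha g \in alpha @* P by rewrite mem_morphim.
have ag1 : alpha g ^+ #|G : P| = 1.
  rewrite -(fmodK abP (groupX _ aPg)) fmodX // Vg.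
  exact: fmval0.
have oag : p.-nat #[alpha g].
  exact: mem_p_elt (morphim_pgroup _ pP) aPg.
have := pnat_1 oag (pnat_dvd _ p'GP).
rewrite order_dvdn ag1 eqxx => /(_ isT) /eqP.
rewrite order_eq1 => /eqP; apply: coset_idr.
exact: subsetP (der_norm 1 P) g Pg.
Qed.

(** Frobenius' condition that all the quotients ['N_G(D) / 'C_G(D)], for [D] a
    [p]-subgroup of [G], are [p]-groups.  Stated with subgroups [Q] of
    prime-power order, it passes to subgroups of [G] at once. *)
Definition p'_acts_trivially G :=
  forall q D Q, prime q -> q != p -> p.-group D -> q.-group Q ->
    D \subset G -> Q \subset G -> Q \subset 'N(D) -> Q \subset 'C(D).

(** No prime [q] other than [p] divides [#|'N_G(D) : 'C_G(D)|], because a Sylow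
    [q]-subgroup of ['N_G(D)] lies in ['C_G(D)]. *)
Lemma normalizer_Sylow_cent G D T :
    p'_acts_trivially G -> D \subset G -> p.-group D ->
    p.-Sylow('N_G(D)) T ->
  'N_G(D) \subset 'C_G(D) * T.
Proof.
move=> cG sDG pD sylT.
have nC : 'N_G(D) \subset 'N('C_G(D)).
  by rewrite normsI ?norms_cent ?subsetIr // normsG ?subsetIl.
have sTN := pHall_sub sylT.
rewrite -quotientSK //.
have pNC : p.-group ('N_G(D) / 'C_G(D)).
  apply/pgroupP=> q q_pr; apply: contraLR => neq_qp.
  have [Q sylQ] := Sylow_exists q 'N_G(D).
  have [sQG sQN] : Q \subset G /\ Q \subset 'N(D).
    by apply/andP; rewrite -subsetI (pHall_sub sylQ).
  have sQC : Q \subset 'C_G(D).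
    by rewrite subsetI sQG (cG q) // (pHall_pgroup sylQ).
  have := quotient_pHall (subset_trans (pHall_sub sylQ) nC) sylQ.
  rewrite (quotientS1 sQC) => /card_Hall /esym/eqP.
  by rewrite cards1 p_part_eq1 mem_primes q_pr cardG_gt0.
by rewrite (pHall_id (quotient_pHall (subset_trans sTN nC) sylT)).
Qed.

(** Downward induction on [#|P :&: S|].  If [D := P :&: S] is not [P], it is
    proper in both ['N_P(D)] and ['N_S(D)].  Up to conjugating [S] by some [c]
    in ['C_G(D)], these two subgroups lie in a common Sylow subgroup [T] of
    ['N_G(D)], hence in a Sylow subgroup [R] of [G]; induction applies to the
    pairs [P], [R] and [R], [S :^ c], whose intersections are larger than
    [D]. *)
Lemma Sylow_conj_cent G P S :
    p'_acts_trivially G -> p.-Sylow(G) P -> p.-Sylow(G) S ->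
  exists2 c, c \in 'C_G(P :&: S) & S :=: P :^ c.
Proof.
move=> cG; move: {2}_.+1 (ltnSn (#|G| - #|P :&: S|)) => n.
elim: n => // n IHn in P S *; rewrite ltnS => leGPS sylP sylS.
have [sPG pP _] := and3P sylP; have [sSG pS _] := and3P sylS.
have oPS : #|P| = #|S| by rewrite (card_Hall sylP) (card_Hall sylS).
have [sPS | not_sPS] := boolP (P \subset S).
  exists 1; first exact: group1.
  by rewrite conjsg1; apply/esym/eqP; rewrite eqEcard sPS oPS /=.
pose D := (P :&: S)%G.
have prDP : D \proper P by rewrite /proper subsetIl subsetI subxx.
have prDS : D \proper S.
  by rewrite properEcard subsetIr -oPS; apply: proper_card.
have sDG : D \subset G := subset_trans (proper_sub prDP) sPG.
have pD : p.-group D := pgroupS (proper_sub prDP) pP.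
have prNP := nilpotent_proper_norm (pgroup_nil pP) prDP.
have prNS := nilpotent_proper_norm (pgroup_nil pS) prDS.
have IH P1 S1 : p.-Sylow(G) P1 -> p.-Sylow(G) S1 -> #|D| < #|P1 :&: S1| ->
    exists2 c, c \in 'C_G(P1 :&: S1) & S1 :=: P1 :^ c.
  move=> sylP1 sylS1 ltD; apply: IHn => //; apply: leq_trans leGPS.
  apply: ltn_sub2l => //; apply: leq_trans ltD _.
  by rewrite subset_leq_card // subIset // (pHall_sub sylP1).
have sNPN : 'N_P(D) \subset 'N_G(D) by rewrite setSI.
have sNSN : 'N_S(D) \subset 'N_G(D) by rewrite setSI.
have [T sylT sNPT] := Sylow_superset sNPN (pgroupS (subsetIl _ _) pP).
have [x Nx sNSxT] := Sylow_Jsub sylT sNSN (pgroupS (subsetIl _ _) pS).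
have /mulsgP[c t Cc Tt def_x] :=
  subsetP (normalizer_Sylow_cent cG sDG pD sylT) x Nx.
have sNScT : 'N_S(D) :^ c \subset T.
  by rewrite -(conjSg _ _ t) -conjsgM -def_x (conjGid Tt).
have pT := pHall_pgroup sylT.
have sTG : T \subset G := subset_trans (pHall_sub sylT) (subsetIl _ _).
have [R sylR sTR] := Sylow_superset sTG pT.
have [Gc CDc] := setIP Cc.
have sylSc : p.-Sylow(G) (S :^ c) by rewrite pHallJ.
have sN1 : 'N_P(D) \subset P :&: R.
  by rewrite subsetI subsetIl (subset_trans sNPT).
have sN2 : 'N_S(D) :^ c \subset R :&: (S :^ c).
  by rewrite subsetI (subset_trans sNScT) // conjSg subsetIl.
have [|c2 /setIP[Gc2 Cc2] defR] := IH P R sylP sylR.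
  exact: leq_trans (proper_card prNP) (subset_leq_card sN1).
have [|c3 /setIP[Gc3 Cc3] defS] := IH R (S :^ c)%G sylR sylSc.
  by apply: leq_trans (subset_leq_card sN2); rewrite cardJg; apply: proper_card.
exists (c2 * c3 * c^-1).
  rewrite inE !groupM ?groupV //=.
    apply: subsetP Cc2; apply: centS; apply: subset_trans sN1.
    exact: proper_sub.
  apply: subsetP Cc3; apply: centS; apply: subset_trans sN2.
  have defDc : D :^ c = D by apply: normP; apply: (subsetP (cent_sub D)).
  by rewrite -[P :&: S]/(gval D) -{1}defDc conjSg proper_sub.
by rewrite !conjsgM -defR -defS /= -conjsgM mulgV conjsg1.
Qed.

(** [P] and [P :^ g^-1] both contain [x], so an element [c] of ['C_G[x]] carries
    one to the other; then [c * g] normalises [P] and acts on [x] as [g]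
    does. *)
Lemma Sylow_fusion_control G P x g :
    p'_acts_trivially G -> p.-Sylow(G) P -> x \in P -> g \in G -> x ^ g \in P ->
  exists2 h, h \in P & x ^ g = x ^ h.
Proof.
move=> cG sylP Px Gg Pxg; have [sPG pP _] := and3P sylP.
have sylPg : p.-Sylow(G) (P :^ g^-1) by rewrite pHallJ ?groupV.
have [c /setIP[Gc Cc] defPc] := Sylow_conj_cent cG sylP sylPg.
have cx : x ^ c = x.
  apply/conjg_fixP/commgP/commute_sym; apply: (centP Cc).
  by rewrite inE Px mem_conjgV.
have Ncg : c * g \in 'N_G(P).
  rewrite inE groupM //; apply/normP.
  by rewrite conjsgM -defPc -conjsgM mulVg conjsg1.
have sylN : p.-Sylow('N_G(P)) P by rewrite Sylow_subnorm.
have /mulsgP[c' h /setIP[_ Cc'] Ph def_cg] :=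
  subsetP (normalizer_Sylow_cent cG sPG pP sylN) _ Ncg.
exists h => //; rewrite -{1}cx -conjgM def_cg conjgM; congr (_ ^ h).
by rewrite conjgE -(centP Cc' _ Px) mulKg.
Qed.

(** The [p]-nilpotency criterion of Frobenius.  A normal [p]-complement of the
    normal subgroup [M], of index a power of [p] in [G], is characteristic in
    [M], hence is one for [G]. *)
Theorem Frobenius_p_nilpotent G :
  p'_acts_trivially G -> p_nilpotent p G.
Proof.
move: {2}_.+1 (ltnSn #|G|) => n.
elim: n G => // n IHn G; rewrite ltnS => leGn cG.
have [P sylP] := Sylow_exists p G; have [sPG pP _] := and3P sylP.
have focal : P :&: G^`(1) \subset P^`(1).
  apply: (focal_subgroup_controlled sylP) => x g.
  exact: Sylow_fusion_control.
have [P1 | ntP] := eqVneq P 1%G.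
  exists G; rewrite ?normal_refl // pHallE subxx /=.
  rewrite -{1}(partnC p (cardG_gt0 G)).
  by rewrite -(card_Hall sylP) P1 cards1 mul1n.
(* [G / M] is the largest abelian [p]-quotient of [G]. *)
pose M := (coset G^`(1) @*^-1 'O_p^'(G / G^`(1)))%G.
have nsG'G : G^`(1) <| G := der_normal 1 G.
have nsMG : M <| G.
  by rewrite -(quotientGK nsG'G) cosetpre_normal pcore_normal.
have hallO : p^'.-Hall(G / G^`(1)) 'O_p^'(G / G^`(1)).
  by apply: nilpotent_pcore_Hall; apply/abelian_nil/der_abelian.
have pGM : p.-nat #|G : M|.
  rewrite -(quotientGK nsG'G) index_cosetpre.
  by case/and3P: hallO; rewrite pnatNK.
have ltMG : M \proper G.
  rewrite properEneq normal_sub // andbT; apply/eqP=> defM.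
  have p'GG' : p^'.-group (G / G^`(1)).
    have <- : 'O_p^'(G / G^`(1)) = G / G^`(1).
      by rewrite -[LHS]cosetpreK [X in X / _]defM.
    exact: pcore_pgroup.
  have sPG' : P \subset G^`(1).
    rewrite -quotient_sub1 ?(subset_trans sPG) ?der_norm //.
    rewrite subG1 trivg_card1; apply/eqP.
    apply: (@pnat_1 p); first exact: quotient_pgroup.
    exact: pgroupS (quotientS _ sPG) p'GG'.
  have := sol_der1_proper (pgroup_sol pP) (subxx P) ntP.
  by rewrite properE (subset_trans _ focal) ?andbF // subsetI subxx.
have [||K nsKM hallK] := IHn M.
- exact: leq_trans (proper_card ltMG) leGn.
- move=> q D Q q_pr neq pD qQ sDM sQM; apply: (cG q) => //.
  - exact: subset_trans sDM (proper_sub ltMG).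
  - exact: subset_trans sQM (proper_sub ltMG).
exists K.
  rewrite -(normal_Hall_pcore hallK nsKM).
  by apply: gFnormal_trans.
have [sKM p'K pMK] := and3P hallK; have sMG := normal_sub nsMG.
rewrite /pHall (subset_trans sKM) //= p'K.
by rewrite -(Lagrange_index sMG sKM) pnatM pMK pnatNK pGM.
Qed.
End Frobenius.

(** * Weakly S-Phi-supplemented subgroups *)

Section Supplements.
Variables (gT : finGroupType).
Implicit Types G M A H L : {group gT}.

(** Sylow subgroups of [M] are traces on [M] of Sylow subgroups of [G]; the
    modular law carries [A * R = R * A] to [A * (M :&: R)]. *)
Lemma s_permutableS G M A :
  A \subset M -> M \subset G -> s_permutable G A -> s_permutable M A.
Proof.
move=> sAM sMG /andP[_ /forall_inP permA]; rewrite /s_permutable sAM /=.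
apply/forall_inP=> Q /SylowP[q q_pr sylQ].
have [sQM qQ _] := and3P sylQ.
have [R sylR sQR] := Sylow_superset (subset_trans sQM sMG) qQ.
have defQ : Q :=: M :&: R.
  apply: esym; apply: (sub_pHall sylQ); rewrite ?subsetIl //.
    exact: pgroupS (subsetIr _ _) (pHall_pgroup sylR).
  by rewrite subsetI sQM.
have /eqP cAR : A * R == R * A by apply/permA/SylowP; exists q.
by rewrite defQ [in X in A * X]setIC group_modl // group_modr // cAR setIC.
Qed.

Lemma s_coreS G M H :
  H \subset M -> M \subset G -> s_core G H \subset s_core M H.
Proof.
move=> sHM sMG; apply: genS; apply/bigcupsP=> A /andP[sAH permA].
apply: (bigcup_max A) => //; rewrite sAH /=.
by apply: s_permutableS permA => //; apply: subset_trans sHM.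
Qed.

(** This allows a supplementation hypothesis on [G] to be used inside a group
    [E <*> Q], and to be inherited by smaller such groups in an induction. *)
Lemma weakly_sPhi_supplementedS G M H :
    H \subset M -> M \subset G ->
  weakly_sPhi_supplemented G H -> weakly_sPhi_supplemented M H.
Proof.
move=> sHM sMG [T [sTG defG sHT]]; exists (T :&: M)%G; split.
- exact: subsetIr.
- by rewrite group_modl // -defG (setIidPr sMG).
apply: subset_trans (mulgS _ (s_coreS sHM sMG)).
by apply: subset_trans sHT; rewrite setIS ?subsetIl.
Qed.

(** If [x] generates [H], all proper subgroups of [H] lie in [<[x ^+ 2]>],
    ['Phi(H)] among them; if [H] is not S-permutable, so does [s_core L H], and
    then a supplement [T] containing [H] with [H :&: T] inside
    ['Phi(H) * s_core L H] would give [H \subset <[x ^+ 2]>]. *)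
Lemma C4_supplement_not_sub L H :
    cyclic H -> #|H| = 4 -> weakly_sPhi_supplemented L H ->
    ~~ s_permutable L H ->
  exists T : {group gT}, [/\ T \subset L, L :=: H * T & ~~ (H \subset T)].
Proof.
move=> cycH oH [T [sTL defL sHT]] npermH; exists T; split=> //.
apply: contra npermH => /setIidPl defH; rewrite defH in sHT.
have [x defx] := cyclicP cycH.
have ox : #[x] = 4 by rewrite orderE -defx.
have prop4 (K : {group gT}) : K \proper H -> K \subset <[x ^+ 2]>.
  move=> prK; have sKH := proper_sub prK.
  rewrite -(cardSg_cyclic cycH) //; last by rewrite defx cycleX.
  rewrite -orderE orderXdiv ox //.
  have := cardSg sKH; have := proper_card prK; rewrite oH.
  by case: #|K| => [|[|[|[|]]]].
have ntH : H :!=: 1 by rewrite trivg_card1 oH.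
have sPhi : 'Phi(H) \subset <[x ^+ 2]>.
  by apply: (prop4 'Phi(H)%G); apply: Phi_proper.
apply: contraT => npermH.
have sCore : s_core L H \subset <[x ^+ 2]>.
  rewrite gen_subG; apply/bigcupsP=> A /andP[sAH permA].
  apply: prop4; rewrite properEneq sAH andbT.
  by apply: contraNneq npermH => <-.
have : H \subset <[x ^+ 2]> by rewrite (subset_trans sHT) // mul_subG.
by move/cardSg; rewrite -orderE orderXdiv ox // oH.
Qed.

End Supplements.

(** * Coprime action on a p-group with central elements of order p *)

Section CoprimeAction.
Variables (gT : finGroupType).
Implicit Types H D Q E F : {group gT}.

(** [Q] centralises [D / [~: D, Q]], and by coprimality fixed points lift:
    [D = [~: D, Q] * 'C_D(Q)]. *)
Lemma coprime_comm_cent D Q :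
    coprime #|D| #|Q| -> solvable D -> Q \subset 'N(D) ->
  Q \subset 'C([~: D, Q]) -> Q \subset 'C(D).
Proof.
move=> coDQ solD nDQ cRQ; have sRD : [~: D, Q] \subset D by rewrite commg_subl.
have nRD : D \subset 'N([~: D, Q]) := commg_norml _ _.
have nRQ : Q \subset 'N([~: D, Q]) := commg_normr _ _.
have := coprime_quotient_cent sRD nRQ coDQ solD.
rewrite (setIidPl (quotient_cents2r (subxx [~: D, Q]))) => eqC.
have : D / [~: D, Q] \subset 'C_D(Q) / [~: D, Q] by rewrite eqC.
rewrite quotientSGK //; first by rewrite subsetI centsC => /andP[].
by rewrite subsetI sRD centsC.
Qed.

(** Since [x ^+ p] is central, [Q] fixes it, so [x ^ y = x * [~ x, y]] has the
    same [p]-th power as [x].  In class 2 and for [p] odd, taking [p]-th powers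
    is multiplicative here because ['Z(E)] has exponent [p], which divides
    ['C(p, 2)], and so [[~ x, y] ^+ p = 1]. *)
Lemma special_odd_commg_exp p E Q x y :
    odd p -> p.-group E -> special E -> Q \subset 'N(E) ->
    'Z(E) \subset 'C(Q) -> x \in E -> y \in Q -> [~ x, y] ^+ p = 1.
Proof.
move=> odd_p pE spE nEQ cZQ Ex Qy; have [defPhi defE'] := spE.
have /and3P[_ _ expZ] := center_special_abelem pE spE.
have Zxp : x ^+ p \in 'Z(E).
  rewrite -defPhi (Phi_joing pE) mem_gen // inE orbC.
  by rewrite (Mho_p_elt 1) ?(mem_p_elt pE).
have Ec : [~ x, y] \in E.
  have : [~: E, Q] \subset E by rewrite commg_subl.
  by move/subsetP; apply; rewrite mem_commg.
have Zcx : [~ [~ x, y], x] \in 'Z(E) by rewrite -defE' mem_commg.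
have [_ cEz] := setIP Zcx.
have cxp : (x * [~ x, y]) ^+ p = x ^+ p.
  rewrite -conjg_mulR -conjXg; apply/conjg_fixP/commgP.
  exact: (centsP cZQ).
move: cxp; rewrite expMg_Rmul; last 2 first.
- exact/commute_sym/(centP cEz).
- exact/commute_sym/(centP cEz).
have [k ->] : exists k, 'C(p, 2) = (p * k)%N by exists p.-1./2; apply: bin2odd.
rewrite expgM (exponentP expZ _ Zcx) expg1n mulg1 -{2}[x ^+ p]mulg1.
exact: mulgI.
Qed.

(** Induction on [#|E|], the inductive hypothesis being that [Q] centralises
    each proper [Q]-invariant subgroup of [E].  If [E] is abelian, it is the
    direct product of [[~: E, Q]] and ['C_E(Q)], so [E = [~: E, Q]] has no fixed
    point of order [p] and is trivial.  Otherwise [abelian_charsimple_special]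
    shows that [E] is special with centre ['C_E(Q)], so of exponent dividing
    [p ^ 2]. *)
Lemma cent_of_weak_supplements p q E Q :
    prime p -> prime q -> q != p -> p.-group E -> q.-group Q ->
    Q \subset 'N(E) ->
    (forall x, x \in E -> #[x] = p -> x \in 'C(Q)) ->
    (p = 2 -> forall H, H \subset E -> cyclic H -> #|H| = 4 ->
       weakly_sPhi_supplemented (E <*> Q) H) ->
  Q \subset 'C(E).
Proof.
move=> p_pr q_pr neq_qp; move: {2}_.+1 (ltnSn #|E|) => n.
elim: n E => // n IHn E; rewrite ltnS => leEn pE qQ nEQ cpQ supE.
have coEQ : coprime #|E| #|Q|.
  apply: pnat_coprime pE _; apply: pi_pnat qQ _.
  by rewrite !inE.
have IH F : F \proper E -> Q \subset 'N(F) -> Q \subset 'C(F).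
  move=> prF nFQ; have sFE := proper_sub prF; apply: IHn => //.
  - exact: leq_trans (proper_card prF) leEn.
  - exact: pgroupS pE.
  - by move=> x Fx; apply: cpQ; apply: (subsetP sFE).
  move=> p2 H sHF cycH oH.
  apply: weakly_sPhi_supplementedS (supE p2 H _ cycH oH).
  - exact: subset_trans sHF (joing_subl _ _).
  - exact: genS (setSU _ _).
  - exact: subset_trans sHF _.
have solE := pgroup_sol pE.
have sRE : [~: E, Q] \subset E by rewrite commg_subl.
have [defR | neqR] := eqVneq [~: E, Q] E; last first.
  apply: coprime_comm_cent => //; apply: IH; last exact: commg_normr.
  by rewrite properEneq neqR.
have [abE | nabE] := boolP (abelian E).
  have := coprime_abel_cent_TI nEQ coEQ abE; rewrite defR => tiE.
  have [-> | ntE] := eqVneq E 1%G; first exact: cents1.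
  have [_ p_dv_E _] := pgroup_pdiv pE ntE.
  have [x Ex ox] := Cauchy p_pr p_dv_E.
  have : x \in 'C_E(Q) by rewrite inE Ex cpQ.
  by rewrite tiE => /set1P x1; move: p_pr; rewrite -ox x1 order1.
have neqE F : abelian F -> F \subset E -> F \proper E.
  move=> abF sFE; rewrite properEneq sFE andbT.
  by apply: contraNneq nabE => <-.
have [spE defZ] : special E /\ 'C_E(Q) = 'Z(E).
  apply: abelian_charsimple_special pE coEQ defR _.
  apply/bigcupsP=> F /andP[chF abF]; rewrite centsC; apply: IH.
    exact/neqE/char_sub.
  exact: char_norm_trans chF nEQ.
have cZQ : 'Z(E) \subset 'C(Q) by rewrite -defZ subsetIr.
have [p2 | odd_p] := even_prime p_pr; last first.
  rewrite centsC -{1}defR gen_subG; apply/subsetP=> _ /imset2P[x y Ex Qy ->].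
  have Exy : [~ x, y] \in E by apply: (subsetP sRE); rewrite mem_commg.
  have := special_odd_commg_exp odd_p pE spE nEQ cZQ Ex Qy.
  move/eqP; rewrite -order_dvdn.
  case/primeP: (p_pr) => _ dvp /dvp /pred2P[] oxy.
    by move/eqP: oxy; rewrite order_eq1 => /eqP->; apply: group1.
  exact: cpQ.
rewrite centsC; apply/subsetP=> x Ex; apply: contraT => ncxQ.
have ox : #[x] = 4.
  have : #[x] %| p ^ 2.
    exact: dvdn_trans (dvdn_exponent Ex) (exponent_special pE spE).
  case/(dvdn_pfactor _ _ p_pr) => -[|[|[|k]]] // _ ox.
  - by move/eqP: ox ncxQ; rewrite order_eq1 => /eqP->; rewrite group1.
  - by rewrite (cpQ x) in ncxQ.
  - by rewrite ox p2.
pose H := <[x]>%G.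
have sHE : H \subset E by rewrite cycle_subG.
have prH : H \proper E by apply: neqE; rewrite ?cycle_abelian.
have nHQ : ~~ (Q \subset 'N(H)).
  apply: contra ncxQ => /(IH _ prH); rewrite centsC => /subsetP; apply.
  exact: cycle_id.
pose L := (E <*> Q)%G.
have defL : L :=: E * Q by rewrite /L /= norm_joinEr.
have sEL : E \subset L := joing_subl _ _.
have tiQE : Q :&: E = 1 by rewrite setIC coprime_TIg.
have p'q_E : q^'.-nat #|E|.
  by apply: pi_pnat pE _; rewrite !inE eq_sym.
have sylQ : q.-Sylow(L) Q.
  rewrite /pHall joing_subr qQ -divgS ?joing_subr //= norm_joinEr //.
  by rewrite TI_cardMg 1?setIC // mulnK.
have npermH : ~~ s_permutable L H.
  apply: contra nHQ => /andP[_ /forall_inP permH].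
  have /eqP cHQ : H * Q == Q * H by apply/permH/SylowP; exists q.
  have defH : H :=: (H <*> Q) :&: E.
    by rewrite comm_joingE // -group_modl // tiQE mulg1.
  rewrite [X in 'N(X)]defH normsI //.
  exact: subset_trans (joing_subr _ _) (normG _).
have cycH : cyclic H := cycle_cyclic x.
have [T [sTL defLT nHT]] :=
  C4_supplement_not_sub cycH ox (supE p2 H sHE cycH ox) npermH.
have [S sylS] := Sylow_exists q T.
(* The index of [T] in [L] divides [#|H|], a power of [p]. *)
have sylSL : q.-Sylow(L) S.
  have [sST qS q'TS] := and3P sylS.
  rewrite /pHall (subset_trans sST) // qS.
  rewrite -(Lagrange_index sTL sST) pnatM q'TS andbT.
  have -> : #|L : T| = #|H : T|.
    apply/eqP; rewrite -(eqn_pmul2r (cardG_gt0 T)) (LagrangeMr H T).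
    by rewrite -defLT mulnC Lagrange.
  exact: pnat_dvd (dvdn_trans (dvdn_indexg _ _) (cardSg sHE)) p'q_E.
have [u Eu defS] : exists2 u, u \in E & S :=: Q :^ u.
  have [l Ll ->] := Sylow_trans sylQ sylSL.
  move: Ll; rewrite defL -(normC nEQ) => /mulsgP[v u Qv Eu ->].
  by exists u => //; rewrite conjsgM (conjGid Qv).
(* [Q :^ u] normalises [M], so [Q] normalises the proper subgroup [M :^ u^-1]
   of [E]: it is centralised by [Q], hence central in [E]. *)
pose M := (T :&: E)%G.
have sMZ : M \subset 'Z(E).
  have prM : M :^ u^-1 \proper E.
    rewrite -(conjGid (groupVr Eu)) properJ properE subsetIr /=.
    rewrite subsetI subxx andbT; apply: contra nHT.
    exact: subset_trans sHE.
  have nMQ : Q \subset 'N(M :^ u^-1).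
    rewrite normJ -sub_conjg -defS normsI //.
      exact: subset_trans (pHall_sub sylS) (normG T).
    apply: subset_trans (pHall_sub sylSL) _.
    by rewrite join_subG normG.
  have /= := IH _ prM nMQ; rewrite centsC => cMQ.
  have : M :^ u^-1 \subset 'Z(E) by rewrite -defZ subsetI proper_sub.
  rewrite sub_conjgV.
  have /normP-> // : u \in 'N('Z(E)).
  by apply: subsetP Eu; apply: gFnorm.
have defE : E :=: H * M by rewrite group_modl // -defLT; apply/esym/setIidPr.
case/negP: nabE; apply: cyclic_center_factor_abelian.
have nZ : E \subset 'N('Z(E)) by apply: gFnorm.
have -> : E / 'Z(E) = H / 'Z(E).
  rewrite [X in X / _]defE quotientMl ?(subset_trans sHE) //.
  by rewrite (quotientS1 sMZ) mulg1.
exact/quotient_cyclic/cycle_cyclic.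
Qed.

End CoprimeAction.

(** * The theorem *)

(** In [G / N], the image of [Q] lies in the normal [p]-complement [K], so the
    commutator of the images of [D] and [Q] lies both in [K], which is normal,
    and in the [p]-group [D / N], which [Q / N] normalises. *)
Lemma commg_sub_p_nilpotent_quotient (gT : finGroupType) p q
    (G N D Q : {group gT}) :
    N <| G -> p_nilpotent p (G / N) -> q != p -> p.-group D -> q.-group Q ->
    D \subset G -> Q \subset G -> Q \subset 'N(D) ->
  [~: D, Q] \subset N.
Proof.
move=> nsNG [K nsK hallK] neq_qp pD qQ sDG sQG nDQ.
have nNG := normal_norm nsNG.
have [nND nNQ] := (subset_trans sDG nNG, subset_trans sQG nNG).
have sQK : Q / N \subset K.
  rewrite (sub_normal_Hall hallK nsK) ?quotientS // quotient_pgroup //.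
  by apply: pi_pnat qQ _; rewrite !inE.
have nDQ' : Q / N \subset 'N(D / N) by apply: quotient_norms.
have nKD : D / N \subset 'N(K).
  by rewrite (subset_trans _ (normal_norm nsK)) ?quotientS.
have tiKD : D / N :&: K = 1.
  apply: coprime_TIg; apply: pnat_coprime (pHall_pgroup hallK).
  exact: quotient_pgroup.
rewrite -quotient_cents2 //; apply/commG1P/trivgP; rewrite -tiKD subsetI.
rewrite commg_subl nDQ' /= (subset_trans (commgS _ sQK)) //.
by rewrite commg_subr.
Qed.

Unset Implicit Arguments.

Theorem theorem1p6 (gT : finGroupType) (p : nat) (G N : {group gT})
    (p_pr : prime p) (nsNG : N <| G) (nilGN : p_nilpotent p (G / N))
    (central_p : forall H : {group gT},
       H \subset N -> #|H| = p -> H \subset 'Z(G))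
    (supp_4 : p = 2 -> forall H : {group gT},
       H \subset N -> cyclic H -> #|H| = 4 -> weakly_sPhi_supplemented G H) :
  p_nilpotent p G.
Proof.
apply: Frobenius_p_nilpotent => q D Q q_pr neq_qp pD qQ sDG sQG nDQ.
have sRN := commg_sub_p_nilpotent_quotient nsNG nilGN neq_qp pD qQ sDG sQG nDQ.
have sRD : [~: D, Q] \subset D by rewrite commg_subl.
apply: coprime_comm_cent (pgroup_sol pD) nDQ _.
  by apply: pnat_coprime pD _; apply: pi_pnat qQ _; rewrite !inE.
apply: (cent_of_weak_supplements p_pr q_pr neq_qp) => //=.
- exact: pgroupS pD.
- exact: commg_normr.
- move=> x Rx ox; have : <[x]> \subset 'Z(G).
    by apply: central_p; rewrite // cycle_subG (subsetP sRN).
  rewrite cycle_subG => /setIP[_]; apply: subsetP; exact: centS.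
move=> p2 H sHR cycH oH.
apply: weakly_sPhi_supplementedS (supp_4 p2 H _ cycH oH).
- exact: subset_trans sHR (joing_subl _ _).
- by rewrite join_subG sQG (subset_trans sRD).
- exact: subset_trans sRN.
Qed.
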